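(* Let $w\in\{0,1\}^*$ be a finite binary word. If $w$ is good, then $\delta(w)$ is good.
   Context: Words are over the alphabet $\{0,1\}$. A factor of a word is a contiguous subword. A morphism $g:\{0,1\}^*\to\{0,1\}^*$ is written $g=[g(0),g(1)]$; it is non-erasing if $g(0)$ and $g(1)$ are both non-empty. A word $w$ encounters a pattern $p\in\{0,1\}^*$ if $g(p)$ is a factor of $w$ for some non-erasing morphism $g:\{0,1\}^*\to\{0,1\}^*$. A binary word is called good if it contains neither $11$ nor $1001$ as a factor, and encounters neither of the patterns $0000$ and $00010100$. The period-doubling morphism is $\delta=[01,00]$, i.e. $\delta(0)=01$, $\delta(1)=00$. *)

(* Defs.v *)
From mathcomp Require Import all_boot.
Set Implicit Arguments.
Unset Strict Implicit.
Unset Printing Implicit Defensive.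

(* The letters 0 and 1 are the booleans false and true. *)
Declare Scope letter_scope.
Delimit Scope letter_scope with L.
Notation "0" := false (only parsing) : letter_scope.
Notation "1" := true (only parsing) : letter_scope.

Definition word := seq bool.

(* The equation g [::] = [::] follows by taking u = v = [::]. *)
Definition morphism (g : word -> word) : Prop :=
  forall u v : word, g (u ++ v) = g u ++ g v.

Definition nonerasing (g : word -> word) : Prop :=
  g [:: 0%L] <> [::] /\ g [:: 1%L] <> [::].

(* morph a b is the morphism [a, b], sending 0 to a and 1 to b. *)
Definition morph (a b : word) (w : word) : word :=
  flatten [seq (if x then b else a) | x <- w].

Definition encounters (w p : word) : Prop :=
  exists g : word -> word, [/\ morphism g, nonerasing g & infix (g p) w].

Definition good (w : word) : Prop :=
  [/\ ~ infix [:: 1; 1]%L w,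
      ~ infix [:: 1; 0; 0; 1]%L w,
      ~ encounters w [:: 0; 0; 0; 0]%L &
      ~ encounters w [:: 0; 0; 0; 1; 0; 1; 0; 0]%L].

Definition delta : word -> word := morph [:: 0; 1]%L [:: 0; 0]%L.

Lemma morph_morphism (a b : word) : morphism (morph a b).
Proof. by move=> u v; rewrite /morph map_cat flatten_cat. Qed.

Lemma morph0 (a b : word) : morph a b [:: 0%L] = a.
Proof. exact: cats0. Qed.

Lemma morph1 (a b : word) : morph a b [:: 1%L] = b.
Proof. exact: cats0. Qed.

Lemma morphismE (g : word -> word) :
  morphism g -> g =1 morph (g [:: 0%L]) (g [:: 1%L]).
Proof.
move=> gM; elim=> [|x w IHw].
  by apply: size0nil; apply: (@addnI (size (g [::]))); rewrite -size_cat -gM addn0.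
by rewrite -cat1s gM IHw; case: x.
Qed.

(* Main.v *)
Require Import Defs.
From mathcomp Require Import all_boot.
Set Implicit Arguments.
Unset Strict Implicit.
Unset Printing Implicit Defensive.

(** In [delta w] every letter at an even position is 0, so a word occurring in
    [delta w] at positions of both parities is a power of 0, whereas
    [delta w] avoids 0000 because w avoids 11.  Suppose that a pattern with images
    a, b occurs in [delta w].  If both lengths are even, the occurrence, shifted
    left by one letter when it starts at an odd position, is the image by [delta]
    of an occurrence of the pattern in w.  Otherwise some image is a power of 0,
    and the only case not excluded by 0000 is 000b0b00 with b of odd length; it
    equals [delta] (1vv1) for some v, and 1vv1 cannot avoid 11, 1001 and 0000. *)

Lemma encountersP (w p : word) :
  encounters w p <->
  exists a b : word, [/\ a <> [::], b <> [::] & infix (morph a b p) w].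
Proof.
split=> [[g [gM [g0 g1] gp]]|[a [b [a0 b0 abp]]]].
  by exists (g [:: false]), (g [:: true]); rewrite -morphismE.
exists (morph a b); split=> //; first exact: morph_morphism.
by rewrite /nonerasing morph0 morph1.
Qed.

Lemma encounters_power4 (w a : word) :
  a <> [::] -> infix (a ++ a ++ a ++ a) w -> encounters w [:: 0; 0; 0; 0]%L.
Proof.
by move=> a0 aw; apply/encountersP; exists a, a; rewrite /morph /= cats0.
Qed.

Lemma morph_cons (a b : word) x (w : word) :
  morph a b (x :: w) = (if x then b else a) ++ morph a b w.
Proof. by []. Qed.

(** Moving a final 0 to the front of both images only conjugates the morphism, which lets an
    occurrence slide one letter to the left. *)
Lemma morph_conj (a b x : word) :
  false :: morph (rcons a false) (rcons b false) x =
  rcons (morph (false :: a) (false :: b) x) false.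
Proof.
elim: x => // x s IHs.
by rewrite !morph_cons rcons_cat -IHs; case: x; rewrite /= -cats1 -catA.
Qed.

Lemma delta_cons x (w : word) : delta (x :: w) = [:: false, ~~ x & delta w].
Proof. by case: x. Qed.

Lemma delta_cat (u v : word) : delta (u ++ v) = delta u ++ delta v.
Proof. exact: morph_morphism. Qed.

Lemma delta_inj : injective delta.
Proof.
elim=> [|x u IHu] [|y v] //; rewrite !delta_cons //.
by case=> /negb_inj -> /IHu ->.
Qed.

Lemma delta_morph (a b x : word) :
  delta (morph a b x) = morph (delta a) (delta b) x.
Proof. by elim: x => // x s IHs; rewrite !morph_cons delta_cat IHs; case: x. Qed.

Lemma size_delta (w : word) : odd (size (delta w)) = false.
Proof. by elim: w => // x w IHw; rewrite delta_cons /= negbK. Qed.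

(* [zeros true s] (resp. [zeros false s]): the letters of s at even (resp. odd)
   positions, counted from 0, are all 0. *)
Fixpoint zeros (c : bool) (s : word) : bool :=
  if s is x :: s' then (c ==> ~~ x) && zeros (~~ c) s' else true.

Lemma zeros_cat c (u v : word) :
  zeros c (u ++ v) = zeros c u && zeros (c (+) odd (size u)) v.
Proof.
elim: u c => [|x u IHu] c /=; first by rewrite addbF.
by rewrite IHu andbA addbN addNb.
Qed.

Lemma zeros_delta (w : word) : zeros true (delta w).
Proof. by elim: w => // x w IHw; rewrite delta_cons. Qed.

Lemma zeros_nseq c (s : word) :
  zeros c s -> zeros (~~ c) s -> s = nseq (size s) false.
Proof.
elim: s c => //= x s IHs c /andP[xc sc] /andP[xNc sNc].
by rewrite -(IHs _ sc sNc); case: c x xc xNc {sc sNc} => [] [].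
Qed.

Lemma zeros_deltaP (s : word) :
  zeros true s -> ~~ odd (size s) -> exists v, s = delta v.
Proof.
have [n] := ubnP (size s).
elim: n s => // n IHn [|x [|y s]] //= ltsn; first by exists [::].
case/andP=> /negPf-> zs; rewrite negbK => es.
have [|v ->] := IHn s _ zs es; first exact: ltnW.
by exists (~~ y :: v); rewrite delta_cons negbK.
Qed.

(** An even prefix cuts [delta w] between images of letters, so [p] and [q] are themselves images,
    and [delta_inj] lifts the factorization to [w]. *)
Lemma delta_factor (w p s q : word) :
  delta w = p ++ delta s ++ q -> ~~ odd (size p) -> infix s w.
Proof.
move=> def_w ep; have := zeros_delta w; have := size_delta w.
rewrite def_w !size_cat !oddD size_delta (negPf ep) /= => eq.
rewrite !zeros_cat size_delta (negPf ep) /= => /and3P[zp _ zq].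
have [p' def_p] := zeros_deltaP zp ep.
have [q' def_q] := zeros_deltaP zq (negbT eq).
apply/infixP; exists p', q'; apply: delta_inj.
by rewrite def_w def_p def_q !delta_cat.
Qed.

Lemma zeros_rcons c (s : word) :
  s <> [::] -> zeros c s -> odd (size s) = c ->
  exists t, s = rcons t false.
Proof.
case/lastP: s => // s x _; rewrite -cats1 zeros_cat size_cat addn1 /=.
case/and3P=> _ zx _ odds; exists s.
by rewrite -odds addNb addbb in zx; rewrite (negPf zx) cats1.
Qed.

Lemma delta_encounters (w p q a b x : word) :
  delta w = p ++ morph a b x ++ q -> a <> [::] -> b <> [::] ->
  ~~ odd (size a) -> ~~ odd (size b) ->
  zeros (~~ odd (size p)) a -> zeros (~~ odd (size p)) b ->
  encounters w x.
Proof.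
have even_case p' q' a' b' : delta w = p' ++ morph a' b' x ++ q' ->
    a' <> [::] -> b' <> [::] -> ~~ odd (size a') -> ~~ odd (size b') ->
    ~~ odd (size p') -> zeros true a' -> zeros true b' -> encounters w x.
  move=> def_w a0 b0 ea eb ep za zb.
  have [u def_a] := zeros_deltaP za ea; have [v def_b] := zeros_deltaP zb eb.
  apply/encountersP; exists u, v.
  rewrite def_a def_b -delta_morph in def_w.
  split; last exact: delta_factor def_w ep.
    by move=> u0; apply: a0; rewrite def_a u0.
  by move=> v0; apply: b0; rewrite def_b v0.
move=> def_w a0 b0 ea eb.
have [odd_p|even_p] := boolP (odd (size p)); last first.
  exact: even_case def_w a0 b0 ea eb even_p.
move=> /= za zb.
have zp : zeros true p by move: (zeros_delta w); rewrite def_w zeros_cat; case/andP.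
have p0 : p <> [::] by move=> p0; rewrite p0 in odd_p.
have [p1 def_p] := zeros_rcons p0 zp odd_p.
have [a1 def_a] := zeros_rcons a0 za (negPf ea).
have [b1 def_b] := zeros_rcons b0 zb (negPf eb).
(* The final 0 of [p] enters the occurrence, and the final 0 of the occurrence passes to the
   suffix. *)
have{}def_w :
    delta w = p1 ++ morph (false :: a1) (false :: b1) x ++ false :: q.
  by rewrite def_w def_p def_a def_b cat_rcons -cat_cons morph_conj cat_rcons.
rewrite def_a size_rcons in ea za; rewrite def_b size_rcons in eb zb.
rewrite def_p size_rcons in odd_p.
rewrite -cats1 zeros_cat in za; rewrite -cats1 zeros_cat in zb.
case/andP: za => za _; case/andP: zb => zb _.
exact: even_case def_w _ _ ea eb _ _ _.
Qed.

Lemma delta_0000 (w : word) :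
  ~ infix [:: 1; 1]%L w -> ~ infix [:: 0; 0; 0; 0]%L (delta w).
Proof.
move=> no11 /infixP[p [q def_w]]; apply: no11.
have [odd_p|even_p] := boolP (odd (size p)); last first.
  exact: (@delta_factor w p [:: true; true] q).
have zp : zeros true p by move: (zeros_delta w); rewrite def_w zeros_cat; case/andP.
have p0 : p <> [::] by move=> p0; rewrite p0 in odd_p.
have [p1 def_p] := zeros_rcons p0 zp odd_p.
(* The last 0 of [p] and the first three letters of 0000 form [delta] of 11 at an even position. *)
apply: (@delta_factor w p1 [:: true; true] (false :: q)).
  by rewrite def_w def_p cat_rcons.
by rewrite def_p size_rcons in odd_p.
Qed.

Lemma infix_nseq_0000 (n : nat) (p q s : word) :
  3 < n -> s = p ++ nseq n false ++ q -> infix [:: 0; 0; 0; 0]%L s.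
Proof.
move=> n4 ->; apply/infixP; exists p, (nseq (n - 4) false ++ q).
by rewrite -[in LHS](subnKC n4) nseqD -catA.
Qed.

(* The boundary letters force v to begin with 01 and to end with 10, so the
   junction of vv is 1001. *)
Lemma no_1vv1 (w v : word) :
  ~ infix [:: 1; 1]%L w -> ~ infix [:: 1; 0; 0; 1]%L w ->
  ~ infix [:: 0; 0; 0; 0]%L w -> v <> [::] ->
  ~ infix (true :: v ++ v ++ [:: true]) w.
Proof.
move=> no11 no1001 no0000 v0 vw.
have fac p s q : true :: v ++ v ++ [:: true] = p ++ s ++ q -> infix s w.
  by move=> E; apply: infix_trans vw; rewrite E; apply: infix_infix.
have [t def_v] : exists t, v = rcons t false.
  case/lastP: v v0 fac {vw} => // t [] _ fac; last by exists t.
  case: no11; apply: (fac (true :: rcons t true ++ t) _ [::]).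
  by rewrite /= -!cats1 -!catA.
have [v1 def_v1] : exists v1, v = false :: v1.
  case: v v0 fac {vw def_v} => // [[]] v1 _ fac; last by exists v1.
  by case: no11; apply: (fac [::] _ (v1 ++ (true :: v1) ++ [:: true])).
have [t1 def_t] : exists t1, t = rcons t1 true.
  case/lastP: t def_v => [|t1 x] def_v.
    by case: no1001; apply: (fac [::] _ [::]); rewrite def_v.
  case: x def_v => def_v; first by exists t1.
  (* Now [v] ends in 00. If [v] is 00, then [vv] is 0000; an ending 100 meets the final 1, and an
     ending 000 meets the first 0 of the second [v]. *)
  case/lastP: t1 def_v => [|t2 x] def_v.
    by case: no0000; apply: (fac [:: true] _ [:: true]); rewrite def_v.
  case: x def_v => def_v.
    case: no1001; apply: (fac (true :: v ++ t2) _ [::]).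
    by rewrite {2}def_v /= -!cats1 -!catA.
  case: no0000; apply: (fac (true :: t2) _ (v1 ++ [:: true])).
  by rewrite {2}def_v1 def_v /= -!cats1 -!catA.
have [v2 def_v2] : exists v2, v1 = true :: v2.
  case: v1 def_v1 => [|[] v2] def_v1; [|by exists v2|].
    by case: t1 def_t => [|? [|? ?]] def_t; rewrite def_v def_t in def_v1.
  case: v2 def_v1 => [|[] v3] def_v1.
  - by case: no0000; apply: (fac [:: true] _ [:: true]); rewrite def_v1.
  - by case: no1001; apply: (fac [::] _ (v3 ++ v ++ [:: true])); rewrite {1}def_v1.
  case: no0000; apply: (fac (true :: t) _ (v3 ++ [:: true])).
  by rewrite {1}def_v def_v1 /= -!cats1 -!catA.
case: no1001; apply: (fac (true :: t1) _ (v2 ++ [:: true])).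
by rewrite {1}def_v def_t def_v1 def_v2 /= -!cats1 -!catA.
Qed.

(** Here and in [delta_1001], the two 1s are an odd distance apart, so one of them falls on an even
    position. *)
Lemma delta_11 (w : word) : ~ infix [:: 1; 1]%L (delta w).
Proof.
case/infixP=> p [q def_w]; have := zeros_delta w.
by rewrite def_w !zeros_cat /=; case: odd; rewrite /= !andbF.
Qed.

Lemma delta_1001 (w : word) : ~ infix [:: 1; 0; 0; 1]%L (delta w).
Proof.
case/infixP=> p [q def_w]; have := zeros_delta w.
by rewrite def_w !zeros_cat /=; case: odd; rewrite /= !andbF.
Qed.

Lemma delta_power4 (w : word) :
  ~ infix [:: 1; 1]%L w -> ~ encounters w [:: 0; 0; 0; 0]%L ->
  ~ encounters (delta w) [:: 0; 0; 0; 0]%L.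
Proof.
move=> no11 no4 /encountersP[a [b [a0 _ /infixP[p [q def_w]]]]].
(* The pattern has no letter 1, so [b] may be replaced by [a], whose parity is controlled. *)
have{}def_w : delta w = p ++ morph a a [:: 0; 0; 0; 0]%L ++ q := def_w.
have := zeros_delta w.
rewrite def_w /morph /= cats0 -!catA !zeros_cat => /and5P[_ za za' _ _].
have [odd_a|even_a] := boolP (odd (size a)); last first.
  by exact: no4 (delta_encounters def_w a0 a0 even_a even_a za za).
apply: (delta_0000 no11); rewrite odd_a addbT in za'.
have nil_a := zeros_nseq za za'.
apply: (@infix_nseq_0000 (size (a ++ a ++ a ++ a)) p q).
  by rewrite !size_cat; case: (a) a0 => //= x s _; rewrite !addSn !addnS.
by rewrite def_w /morph /= cats0 !size_cat !nseqD -nil_a.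
Qed.

Lemma delta_aaababaa (w : word) :
  good w -> ~ encounters (delta w) [:: 0; 0; 0; 1; 0; 1; 0; 0]%L.
Proof.
case=> no11 no1001 no4 no8 /encountersP[a [b [a0 b0 /infixP[p [q def_w]]]]].
have no0000 := delta_0000 no11.
have no0000w : ~ infix [:: 0; 0; 0; 0]%L w.
  by move=> zw; apply: no4; apply: (@encounters_power4 w [:: false]).
(* Two adjacent copies of a longer power of 0 would already contain 0000. *)
have nil_a : a = nseq (size a) false -> size a = 1.
  move=> def_a; case Ea: (size a) => [|[|n]] //; first by case: a0; apply: size0nil.
  case: no0000; apply: (@infix_nseq_0000 (size (a ++ a)) p
    (a ++ b ++ a ++ b ++ a ++ a ++ q)).
    by rewrite size_cat Ea !addSn !addnS.
  by rewrite size_cat nseqD -def_a def_w /morph /= cats0 -!catA.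
have := zeros_delta w.
rewrite def_w /morph /= cats0 -!catA !zeros_cat /=.
(* These concern the first, second and fourth copies of [a], and both copies of [b]. *)
case/and5P=> _ za za' _ /and5P[zb za3 zb' _ _].
have [odd_a|even_a] := boolP (odd (size a)).
  have def_a : a = [:: false].
    have Za : a = nseq (size a) false.
      by apply: zeros_nseq za _; rewrite odd_a addbT in za'.
    by rewrite Za nil_a.
  have{}def_w :
      delta w = p ++ (nseq 3 false ++ b ++ false :: b ++ nseq 2 false) ++ q.
    by rewrite def_w /morph /= def_a /= -!catA.
  rewrite def_a /= in zb zb'.
  have b_head b1 : b <> false :: b1.
    move=> def_b; apply: no0000; rewrite def_w def_b; apply/infixP.
    exists p, (b1 ++ false :: (false :: b1) ++ nseq 2 false ++ q).
    by rewrite /= -catA /= -catA.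
  (* For [b] of even length, its two copies would start at opposite parities, making [b] a power of
     0, against [b_head]. *)
  have odd_b : odd (size b).
    apply: contraT => even_b; have Zb : b = nseq (size b) false.
      by apply: zeros_nseq zb _; rewrite (negPf even_b) addbF addbT in zb'.
    case: b b0 b_head Zb {def_w zb zb' za3 even_b} => // x b1 _ b_head [x0 _].
    by case: (b_head b1); rewrite x0.
  have even_p : ~~ odd (size p).
    apply/negP=> odd_p; rewrite odd_p /= in zb.
    case: b b0 b_head zb {def_w zb' za3 odd_b} => //= -[] // b1 _ b_head _.
    exact: (b_head b1).
  (* The occurrence splits as 00, 0b, 0b, 00, with all cuts at even positions. *)
  have [v def_v] : exists v, false :: b = delta v.
    by apply: zeros_deltaP; rewrite /= ?odd_b // (negPf even_p) in zb *.
  have v0 : v <> [::] by move=> v0; rewrite v0 in def_v.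
  apply: (@no_1vv1 w v) => //; apply: (@delta_factor w p _ q) => //.
  by rewrite def_w delta_cons !delta_cat -def_v /= -!catA.
have [odd_b|even_b] := boolP (odd (size b)); last first.
  rewrite !(negPf even_a) !addbF in zb.
  exact: no8 (delta_encounters def_w a0 b0 even_a even_b za zb).
(* The first and fourth copies of [a] start at distance 3|a| + |b|, which is odd. *)
suff Za : a = nseq (size a) false by rewrite nil_a in even_a.
by apply: zeros_nseq za _; rewrite odd_b (negPf even_a) !addbF addbT in za3.
Qed.

Theorem theorem1p5 (w : word) : good w -> good (delta w).
Proof.
move=> gw; case: (gw) => no11 _ no4 _; split.
- exact: delta_11.
- exact: delta_1001.
- exact: delta_power4.
- exact: delta_aaababaa.
Qed.
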